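(* (1) If $f\in\mathcal G$ is a minimal IET and $f$ is reversible by $h\in\mathcal G$, then the group $\langle f,h\rangle$ acts freely on $[0,1)$. (2) There does not exist a minimal IET that is reversible by an infinite order element $h\in\mathcal G$. (3) Any periodic IET is strongly reversible in $\mathcal G$.
   Context: An interval exchange transformation (IET) is a bijection of $[0,1)$ defined by a finite partition of $[0,1)$ into half-open subintervals and a reordering of these intervals by translations; $\mathcal G$ is the group of all IETs. An IET $f$ is minimal if every orbit of $f$ is dense in $[0,1)$; it is periodic if it has finite order. $f$ is reversible by $h$ if $hfh^{-1}=f^{-1}$; $f$ is strongly reversible in $\mathcal G$ if there is $h\in\mathcal G$ with $h^2=\mathrm{Id}$ and $hfh=f^{-1}$. A group acts freely if the only element having some fixed point is the trivial element. *)

(* Defs.v *)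
From HB Require Import structures.
From mathcomp Require Import all_boot all_order all_algebra.
From mathcomp Require Import all_classical all_reals all_analysis.
From mathcomp Require Import lra.

Set Implicit Arguments.
Unset Strict Implicit.
Unset Printing Implicit Defensive.

Import Order.TTheory GRing.Theory Num.Theory.
Import numFieldNormedType.Exports.

Local Open Scope classical_set_scope.
Local Open Scope ring_scope.

Definition unit_itv (R : realType) := {x : R | 0 <= x < 1}.

Definition is_iet (R : realType) (f : unit_itv R -> unit_itv R) : Prop :=
  bijective f /\
  exists (n : nat) (a t : nat -> R),
    [/\ a 0 = 0, a n = 1,
        (forall i, (i < n)%N -> a i < a i.+1) &
        (forall i (x : unit_itv R), (i < n)%N ->
           a i <= val x < a i.+1 -> val (f x) = val x + t i)].

Record iet (R : realType) := Iet {
  iet_fun :> unit_itv R -> unit_itv R;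
  iet_prop : is_iet iet_fun }.

Section IetGroup.
Variable R : realType.
Local Notation I := (unit_itv R).
Implicit Types (f g : I -> I) (s : seq R).

(* Equivalent form of the partition condition, used only to check that [iet]
   is closed under the group operations: [s] contains all break points. *)
Definition broken_at s f := forall x y : I, val x <= val y ->
  (forall c, c \in s -> ~~ (val x < c <= val y)) ->
  val (f y) - val (f x) = val y - val x.

Lemma is_iet_broken f : is_iet f -> exists s, broken_at s f.
Proof.
move=> [_ [n [a [t [a0 an lta ft]]]]]; exists (map a (iota 0 n.+1)) => x y xy sxy.
have piece m : (m <= n)%N -> val x < a m ->
    exists2 i, (i < m)%N & a i <= val x < a i.+1.
  elim: m => [|m IH] mn xm; first by rewrite a0 in xm; case/andP: (valP x); lra.
  have [mx|xm'] := leP (a m) (val x); first by exists m; rewrite ?mx.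
  by have [i im ix] := IH (ltnW mn) xm'; exists i => //; apply: ltnW.
have [|i lin xi] := piece n (leqnn n); first by rewrite an; case/andP: (valP x).
have yi : a i <= val y < a i.+1.
  case/andP: xi => ax xa; rewrite (le_trans ax xy) ltNge; apply/negP => ay.
  have /sxy : a i.+1 \in map a (iota 0 n.+1).
    by apply: map_f; rewrite mem_iota.
  by rewrite xa ay.
by rewrite (ft i x) // (ft i y) //; lra.
Qed.

Lemma broken_is_iet s f : bijective f -> broken_at s f -> is_iet f.
Proof.
move=> bf sf; split=> //.
set u := sort <=%R (undup [seq c <- s | 0 < c < 1]).
set w := 0 :: rcons u 1.
have memu c : (c \in u) = (c \in s) && (0 < c < 1).
  by rewrite mem_sort mem_undup mem_filter andbC.
have sw : sorted <%R w.
  rewrite /w /= rcons_path path_sortedE; last exact: lt_trans.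
  rewrite /u sort_lt_sorted undup_uniq -/u andbT; apply/andP; split.
    by apply/allP => c; rewrite memu => /and3P[].
  have : last 0 u \in 0 :: u by exact: mem_last.
  by rewrite inE memu => /orP[/eqP->|/and3P[]//]; exact: ltr01.
have szw : size w = (size u).+2 by rewrite /= size_rcons.
have z01 : 0 <= (0 : R) < 1 by rewrite lexx ltr01.
pose z : I := Sub 0 z01.
have aI i : (i < (size u).+1)%N -> 0 <= nth 1 w i < 1.
  case: i => [_|i]; first exact: z01.
  rewrite ltnS => iu; rewrite /w /= nth_rcons iu.
  have : nth 1 u i \in u by exact: mem_nth.
  by rewrite memu => /and3P[_ /ltW-> ->].
exists (size u).+1, (nth 1 w),
  (fun i => val (f (insubd z (nth 1 w i))) - nth 1 w i); split.
- by [].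
- by rewrite /= nth_rcons ltnn eqxx.
- by move=> i iu; rewrite (lt_sorted_ltn_nth 1 sw) ?inE ?szw // ltnW.
- move=> i x iu /andP[ax xa]; have vi := insubdK z (aI i iu).
  have := sf (insubd z (nth 1 w i)) x; rewrite vi ax => /(_ isT) fx.
  suff /fx : forall c, c \in s -> ~~ (nth 1 w i < c <= val x) by lra.
  move=> c cs; apply/negP => /andP[ac cx].
  case/andP: (aI i iu) => a0 a1; case/andP: (valP x) => x0 x1.
  have cw : c \in w.
    rewrite inE mem_rcons inE memu cs (le_lt_trans a0 ac) (le_lt_trans cx x1).
    by rewrite !orbT.
  have jw : (index c w < size w)%N by rewrite index_mem.
  move: ac cx; rewrite -(nth_index 1 cw) (lt_sorted_ltn_nth 1 sw) ?inE ?szw //;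
    [|exact: ltnW|by rewrite -szw].
  move=> ij /le_lt_trans /(_ xa); rewrite (lt_sorted_ltn_nth 1 sw) ?inE ?szw //.
  + by rewrite ltnS leqNgt ij.
  + by rewrite -szw.
Qed.

Lemma iet_id_subproof : is_iet (@id I).
Proof. by apply: (@broken_is_iet [::]); [exists id|]. Qed.

Lemma iet_comp_subproof f g : is_iet f -> is_iet g -> is_iet (f \o g).
Proof.
move=> If Ig; have [sf fP] := is_iet_broken If; have [sg gP] := is_iet_broken Ig.
have bg := Ig.1; have bf := If.1; case: (bg) => g' gK g'K.
have z01 : 0 <= (0 : R) < 1 by rewrite lexx ltr01.
pose z : I := Sub 0 z01.
pose s := sg ++ [seq val (g' (insubd z c)) | c <- sf].
apply: (@broken_is_iet s); first exact: bij_comp.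
move=> x y xy sxy /=.
have sgx c : c \in sg -> ~~ (val x < c <= val y).
  by move=> cg; apply: sxy; rewrite mem_cat cg.
have gxy := gP x y xy sgx.
rewrite fP; [exact: gxy|lra|].
move=> c cf; apply/negP => /andP[xc cy].
case/andP: (valP (g x)) => gx0 gx1; case/andP: (valP (g y)) => gy0 gy1.
case/andP: (valP x) => x0 x1; case/andP: (valP y) => y0 y1.
have cI : 0 <= c < 1 by lra.
have pI : 0 <= val x + (c - val (g x)) < 1 by lra.
pose p : I := exist (fun r : R => 0 <= r < 1) _ pI.
have vp : val p = val x + (c - val (g x)) by [].
have gp : val (g p) - val (g x) = val p - val x.
  apply: gP; first by rewrite vp; lra.
  move=> d dg; apply/negP => /andP[xd dp]; move/negP: (sgx d dg); apply.
  by rewrite vp in dp; rewrite xd andTb; lra.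
have gpc : g p = insubd z c by apply: val_inj; rewrite insubdK ?inE //; lra.
have /sxy/negP[] : val (g' (insubd z c)) \in s.
  by rewrite mem_cat; apply/orP; right; apply: (map_f (fun c => val (g' (insubd z c)))).
by rewrite -gpc gK vp; lra.
Qed.

Lemma iet_inv_subproof f g : cancel f g -> cancel g f -> is_iet f -> is_iet g.
Proof.
move=> fK gK If; have [sf fP] := is_iet_broken If.
have z01 : 0 <= (0 : R) < 1 by rewrite lexx ltr01.
pose z : I := Sub 0 z01.
pose s := [seq val (f (insubd z c)) | c <- 0 :: sf].
apply: (@broken_is_iet s); first by exists f.
move=> u v uv suv; set y := g v.
(* the last break point before [y] *)
have [a [as_ ay amax]] : exists a : I, [/\ val (f a) \in s, val a <= val y &
    forall c, c \in sf -> ~~ (val a < c <= val y)].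
  rewrite /s; clear s suv fP; elim: sf => [|c l [a [as_ ay amax]]].
    exists z; split=> //; last by case/andP: (valP y).
    rewrite inE; apply/eqP; congr (val (f _)); apply: val_inj.
    by rewrite insubdK.
  have memS (b : I) : val (f b) \in [seq val (f (insubd z c)) | c <- 0 :: l] ->
      val (f b) \in [seq val (f (insubd z c)) | c <- [:: 0, c & l]].
    by rewrite /= !inE => /orP[->//|->]; rewrite !orbT.
  have [/andP[ac cy]|nac] := boolP (val a < c <= val y).
    have cI : 0 <= c < 1.
      by case/andP: (valP a) => a0 _; case/andP: (valP y) => _ y1; lra.
    exists (insubd z c); rewrite !insubdK //; split=> //.
      by rewrite !inE eqxx orbT.
    move=> d; rewrite inE => /orP[/eqP->|dl]; first by rewrite ltxx.
    apply/negP => /andP[cd dy]; move/negP: (amax d dl); apply.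
    by rewrite dy (lt_trans ac cd).
  exists a; split=> //; first exact: memS.
  by move=> d; rewrite inE => /orP[/eqP->|/amax].
have fay := fP a y ay amax; rewrite gK in fay.
have au : val (f a) <= val u.
  by rewrite leNgt; apply/negP => ua; have /negP[] := suv _ as_; rewrite ua; lra.
case/andP: (valP a) => a0 a1; case/andP: (valP y) => y0 y1.
have pI : 0 <= val a + (val u - val (f a)) < 1 by lra.
pose p : I := exist (fun r : R => 0 <= r < 1) _ pI.
have vp : val p = val a + (val u - val (f a)) by [].
have fp : val (f p) - val (f a) = val p - val a.
  apply: fP; first by rewrite vp; lra.
  move=> d df; apply/negP => /andP[ad dp]; move/negP: (amax d df); apply.
  by rewrite vp in dp; rewrite ad andTb; lra.
have -> : u = f p by apply: val_inj; lra.
by rewrite fK; lra.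
Qed.

Lemma iet_ext (f g : iet R) : f =1 g -> f = g.
Proof.
case: f g => [f fP] [g gP] /= /funext fg; case: _ / fg gP => gP.
by congr Iet; exact: Prop_irrelevance.
Qed.

Lemma iet_inv_ex (f : iet R) : exists g : iet R, cancel f g /\ cancel g f.
Proof.
case: (iet_prop f).1 => g fK gK.
by exists (Iet (iet_inv_subproof fK gK (iet_prop f))).
Qed.

Definition iet_one : iet R := Iet iet_id_subproof.
Definition iet_mul (f g : iet R) : iet R :=
  Iet (iet_comp_subproof (iet_prop f) (iet_prop g)).
Definition iet_inv (f : iet R) : iet R := projT1 (cid (iet_inv_ex f)).

Lemma iet_invK (f : iet R) : cancel f (iet_inv f).
Proof. exact: (projT2 (cid (iet_inv_ex f))).1. Qed.

Lemma iet_Kinv (f : iet R) : cancel (iet_inv f) f.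
Proof. exact: (projT2 (cid (iet_inv_ex f))).2. Qed.

Lemma iet_mulA : associative iet_mul.
Proof. by move=> f g h; exact: iet_ext. Qed.
Lemma iet_mul1 : left_id iet_one iet_mul.
Proof. by move=> f; exact: iet_ext. Qed.
Lemma iet_mulr1 : right_id iet_one iet_mul.
Proof. by move=> f; exact: iet_ext. Qed.
Lemma iet_mulV : left_inverse iet_one iet_inv iet_mul.
Proof. by move=> f; apply: iet_ext => x /=; exact: iet_invK. Qed.
Lemma iet_mulrV : right_inverse iet_one iet_inv iet_mul.
Proof. by move=> f; apply: iet_ext => x /=; exact: iet_Kinv. Qed.

HB.instance Definition _ := gen_eqMixin (iet R).
HB.instance Definition _ := gen_choiceMixin (iet R).
(* The product is composition: [(f * g) x = f (g x)]. *)
HB.instance Definition _ := isGroup.Build (iet R)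
  iet_mulA iet_mul1 iet_mulr1 iet_mulV iet_mulrV.

End IetGroup.

Local Open Scope group_scope.

Definition iet_orbit (R : realType) (f : iet R) (x : unit_itv R) :
    set (unit_itv R) :=
  [set y | exists n : nat, y = (f ^+ n) x \/ y = (f ^- n) x].

Definition minimal_iet (R : realType) (f : iet R) : Prop :=
  forall x : unit_itv R,
    [set y : R | (0 <= y < 1)%R] `<=` closure [set val y | y in iet_orbit f x].

Definition periodic_iet (R : realType) (f : iet R) : Prop :=
  exists2 n : nat, (0 < n)%N & f ^+ n = 1.

Definition infinite_order (R : realType) (f : iet R) : Prop :=
  ~ periodic_iet f.

Definition reversible_by (R : realType) (f h : iet R) : Prop :=
  h * f * h^-1 = f^-1.

Definition strongly_reversible (R : realType) (f : iet R) : Prop :=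
  exists h : iet R, h ^+ 2 = 1 /\ h * f * h = f^-1.

Definition subgroup (G : groupType) (H : set G) : Prop :=
  [/\ H 1, (forall x y, H x -> H y -> H (x * y)) & (forall x, H x -> H x^-1)].

Definition generated_subgroup (G : groupType) (A : set G) : set G :=
  [set x | forall H : set G, subgroup H -> A `<=` H -> H x].

Definition acts_freely (R : realType) (H : set (iet R)) : Prop :=
  forall g : iet R, H g -> (exists x : unit_itv R, g x = x) -> g = 1.

(* Main.v *)
(* Freeness: every [g] in [<f, h>] conjugates [f] to [f] or to [f^-1].  If [g]
   fixes [x] and commutes with [f], it fixes a dense orbit, hence is trivial.  If
   it reverses [f], it is the identity to the right of [x], so that
   [f^k x = g (f^k x) = f^-k x] for some [k <> 0], which minimality forbids.

   Finite order of [h]: linking [i] to [j] when [f^(j - i)] is left-continuous at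
   [f^i z] is a partial equivalence relation on the indices of the orbit of [z].
   Call [z] resolved when all indices of large absolute value are linked.  Since
   [h] has finitely many breaks, it preserves unresolved points, and each
   unresolved orbit contains a break of [f].  Hence, if an unresolved point
   exists, some [f^l h^d] with [d > 0] has a fixed point and is trivial by
   freeness; then [h^d = f^-l] commutes with [h], so [l = 0] and [h^d = 1].  If all
   points are resolved, the breaks of [f^n] lie in [s] or [f^-n s] for a fixed
   finite set [s]; [f] is then rotation-like, and could only be reversed by an
   orientation-reversing map: [h] would satisfy [h (h x) = x - 2 d] for arbitrarily
   small [d > 0] at one of finitely many given points [x]. *)
Require Import Defs.
From mathcomp Require Import all_boot all_order all_algebra.
From mathcomp Require Import all_classical all_reals all_analysis.
From mathcomp Require Import zify lra.

Set Implicit Arguments.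
Unset Strict Implicit.
Unset Printing Implicit Defensive.

Import Order.TTheory GRing.Theory Num.Theory.
Import numFieldNormedType.Exports.

Local Open Scope classical_set_scope.
Local Open Scope ring_scope.

(** * Integer powers in a group *)

Section IntPower.
Variables (G : groupType) (g : G).
Local Open Scope group_scope.

Definition expgz (k : int) : G :=
  match k with Posz n => g ^+ n | Negz n => g ^- n.+1 end.

Lemma expgz_addr1 k : expgz (k + 1)%R = expgz k * g.
Proof.
case: k => [n|[|n]].
- by rewrite (_ : (n%:Z + 1)%R = n.+1) /= ?expgSr //; lia.
- by rewrite (_ : (Negz 0 + 1)%R = 0%N) //= mulVg.
- by rewrite (_ : (Negz n.+1 + 1)%R = Negz n) /= ?[g ^+ n.+2]expgS ?invgM ?mulgVK //; lia.
Qed.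

Lemma expgz_subr1 k : expgz (k - 1)%R = expgz k * g^-1.
Proof. by rewrite -{2}(subrK 1%R k) expgz_addr1 mulgK. Qed.

Lemma expgzD i j : expgz (i + j)%R = expgz i * expgz j.
Proof.
elim/int_rect: j => [|n IH|n IH].
- by rewrite addr0 /= mulg1.
- by rewrite -addn1 PoszD addrA !expgz_addr1 IH mulgA.
- by rewrite -addn1 PoszD opprD addrA !expgz_subr1 IH mulgA.
Qed.

Lemma expgzN i : expgz (- i)%R = (expgz i)^-1.
Proof. by apply: (mulIg (expgz i)); rewrite -expgzD addNr mulVg. Qed.

Lemma expgz_conjV (h : G) k : h * g * h^-1 = g^-1 ->
  h * expgz k = expgz (- k)%R * h.
Proof.
move=> hg; have {}hg : h * g = g^-1 * h by rewrite -hg mulgVK.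
elim/int_rect: k => [|n IH|n IH].
- by rewrite oppr0 /= mulg1 mul1g.
- rewrite -addn1 PoszD expgz_addr1 mulgA IH -mulgA hg.
  by rewrite opprD expgz_subr1 mulgA.
- rewrite -addn1 PoszD opprD expgz_subr1 mulgA IH -mulgA opprB.
  rewrite [(1 - _)%R]addrC expgz_addr1 -mulgA; congr (_ * _).
  by apply: (mulgI g^-1); rewrite !mulgA -hg mulgK mulVg mul1g.
Qed.

End IntPower.

Notation "g ^z k" := (expgz g k) (at level 29, left associativity).

(** * Breaks of an IET as failures of left continuity *)

Section Translation.
Variable R : realType.
Local Notation I := (unit_itv R).
Implicit Types (f g h : iet R) (x y z w : I).

Definition ipt0 : I := exist (fun r : R => 0 <= r < 1) 0
  (introT andP (conj (lexx 0) ltr01)).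

Lemma val_ge0 x : 0 <= val x. Proof. by case/andP: (valP x). Qed.
Lemma val_lt1 x : val x < 1. Proof. by case/andP: (valP x). Qed.

Lemma ipt_exists (r : R) : 0 <= r -> r < 1 -> exists x, val x = r.
Proof.
move=> r0 r1; have r01 : 0 <= r < 1 by rewrite r0.
by exists (exist (fun r : R => 0 <= r < 1) r r01).
Qed.

(** Left continuity of a piecewise translation, stated with an explicit interval so that it composes
    and inverts without limits. *)
Definition left_translation g z := exists2 e : R, 0 < e <= val z &
  forall w, val z - e <= val w <= val z -> val (g z) - val (g w) = val z - val w.

Lemma left_translationM f g z :
  left_translation g z -> left_translation f (g z) ->
  left_translation (f * g)%g z.
Proof.
move=> [d /andP[d0 dz] gz] [e /andP[e0 ez] fz].
exists (Num.min d e) => [|w].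
  by rewrite lt_min d0 e0 ge_min dz.
move=> /andP[zw wz].
have m1 : Num.min d e <= d by rewrite ge_min lexx.
have m2 : Num.min d e <= e by rewrite ge_min lexx orbT.
have gw : val (g z) - val (g w) = val z - val w by apply: gz; lra.
by rewrite -gw; apply: fz; lra.
Qed.

Lemma left_translationV g z :
  left_translation g z -> left_translation g^-1%g (g z).
Proof.
move=> [e /andP[e0 ez] gz].
have z1 := val_lt1 z.
exists e => [|u /andP[u1 u2]].
  (* The image of the left end [val z - e] is nonnegative, whence [e <= val (g z)]. *)
  rewrite e0 andTb; have [w wE] := @ipt_exists (val z - e) ltac:(lra) ltac:(lra).
  have := gz w; rewrite wE lexx andTb => /(_ ltac:(lra)).
  by have := val_ge0 (g w); lra.
have [w wE] := @ipt_exists (val z - (val (g z) - val u)) ltac:(lra) ltac:(lra).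
have gw : g w = u by apply: val_inj; have := gz w; rewrite wE => /(_ ltac:(lra)); lra.
have gK := iet_invK g; rewrite (gK z).
by rewrite -[X in _ - val (_ X)]gw (gK w); lra.
Qed.

(* [0] is never a point of left translation, hence always counts as a break. *)
Lemma breaks_finite g : exists s : seq I,
  forall z, z \notin s -> left_translation g z.
Proof.
have [s gs] := is_iet_broken (iet_prop g).
exists (ipt0 :: map (insubd ipt0) s) => z; rewrite inE negb_or => /andP[z0 zs].
have {}z0 : 0 < val z.
  by rewrite lt_neqAle val_ge0 andbT; apply: contra z0 => /eqP z0; apply/eqP/val_inj.
have {}zs : val z \notin s.
  apply: contra zs => /(map_f (insubd ipt0)) zs.
  suff -> : z = insubd ipt0 (val z) by [].
  by apply: val_inj; rewrite insubdK //; exact: (valP z).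
have [e e0 es] : exists2 e : R, 0 < e &
    forall c, c \in s -> ~~ (val z - e <= c <= val z).
  elim: s zs {gs} => [|c s IH]; first by exists 1.
  rewrite inE negb_or => /andP[zc /IH [e e0 es]].
  have [cz|cz] := ltP c (val z).
    have m1 : Num.min e ((val z - c) / 2) <= e by rewrite ge_min lexx.
    have m2 : Num.min e ((val z - c) / 2) <= (val z - c) / 2.
      by rewrite ge_min lexx orbT.
    exists (Num.min e ((val z - c) / 2)) => [|d].
      by rewrite lt_min e0 andTb; lra.
    rewrite inE => /orP[/eqP->|/es]; first by apply/negP; lra.
    by move=> /negP ed; apply/negP => H; apply: ed; lra.
  exists e => // d; rewrite inE => /orP[/eqP->|/es//].
  by apply/negP => H; move/eqP: zc; apply; lra.
have m1 : Num.min e (val z) <= e by rewrite ge_min lexx.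
exists (Num.min e (val z)) => [|w /andP[w1 w2]].
  by rewrite lt_min e0 z0 ge_min lexx orbT.
apply: gs => // c /es /negP H; apply/negP => H'; apply: H; lra.
Qed.

(** Candidate breaks are discarded one at a time: an interval containing [c] is cut at [c] and
    slightly to its left, and left translation at [c] bridges the middle piece. *)
Lemma translation_on g x y : val x <= val y ->
  (forall z, val x < val z <= val y -> left_translation g z) ->
  val (g y) - val (g x) = val y - val x.
Proof.
move=> xy gxy; have [s gs] := is_iet_broken (iet_prop g).
pose broken (s : seq R) := forall x' y', val x <= val x' -> val x' <= val y' ->
  val y' <= val y -> (forall c, c \in s -> ~~ (val x' < c <= val y')) ->
  val (g y') - val (g x') = val y' - val x'.
have {gs} : broken s by move=> x' y' _ xy' _; exact: gs.
elim: s => [|c s IH] sP; first exact: sP.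
apply: IH => x' y' xx' xy' yy' s'.
have [/andP[xc cy]|nc] := boolP (val x' < c <= val y'); last first.
  by apply: sP => // d; rewrite inE => /orP[/eqP->|/s'].
have [z zc] := ipt_exists (le_trans (val_ge0 x') (ltW xc)) (le_lt_trans cy (val_lt1 y')).
have xz : val x < val z <= val y by rewrite zc (le_lt_trans xx' xc) (le_trans cy yy').
have [e /andP[e0 ez] gz] := gxy z xz.
pose m := Num.max (val x') (c - e).
have mx : val x' <= m by rewrite le_max lexx.
have mc : m < c by rewrite gt_max xc ltrBlDr ltrDl.
have [w wE] := ipt_exists (le_trans (val_ge0 x') mx)
  (lt_trans mc (le_lt_trans cy (val_lt1 y'))).
have E1 : val (g w) - val (g x') = val w - val x'.
  apply: sP; rewrite ?wE //; first exact: ltW (lt_le_trans mc (le_trans cy yy')).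
  move=> d; rewrite inE => /orP[/eqP->|/s']; first by rewrite [c <= m]leNgt mc andbF.
  by apply: contra => /andP[-> dm]; exact: le_trans dm (ltW (lt_le_trans mc cy)).
have E2 : val (g z) - val (g w) = val z - val w.
  by apply: gz; rewrite wE zc le_max lexx orbT ltW.
have E3 : val (g y') - val (g z) = val y' - val z.
  apply: sP; rewrite ?zc //; first exact: le_trans xx' (ltW xc).
  move=> d; rewrite inE => /orP[/eqP->|/s']; first by rewrite ltxx.
  by apply: contra => /andP[cd ->]; rewrite (lt_trans xc cd).
by clear -E1 E2 E3; lra.
Qed.

Lemma near_gap_right (s : seq R) (r : R) :
  \forall e \near 0^'+, forall c, c \in s -> ~~ (r < c < r + e).
Proof.
elim: s => [|c s IH]; first by near=> e.
have [rc|rc] := ltP r c.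
  have cr : 0 < c - r by rewrite subr_gt0.
  near=> e => d; rewrite inE => /orP[/eqP->|]; last by move: d; near: e.
  rewrite rc andTb -leNgt -lerBrDl.
  by near: e; apply: nbhs_right_le.
near=> e => d; rewrite inE => /orP[/eqP->|]; last by move: d; near: e.
by rewrite ltNge rc.
Unshelve. all: by end_near. Qed.

Lemma near_translation_right g x :
  \forall e \near 0^'+, forall y, val x <= val y < val x + e ->
    val (g y) - val (g x) = val y - val x.
Proof.
have [s gs] := is_iet_broken (iet_prop g).
near=> e => y /andP[xy yx]; apply: gs => // c cs.
have : ~~ (val x < c < val x + e) by move: c cs; near: e; exact: near_gap_right.
by move=> /negP H; apply/negP => H'; apply: H; lra.
Unshelve. all: by end_near. Qed.

End Translation.

(** * Minimality, aperiodicity and freeness *)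

Section Minimal.
Variable R : realType.
Local Notation I := (unit_itv R).
Implicit Types (f g h : iet R) (x y z w : I).

Lemma expgz_app f i j x : (f ^z i) ((f ^z j) x) = (f ^z (i + j)) x.
Proof. by rewrite expgzD. Qed.

Lemma expgz_fix f i j x : (f ^z i) x = x -> (f ^z (j * i)) x = x.
Proof.
move=> fx; elim/int_rect: j => [|n IH|n IH].
- by rewrite mul0r.
- by rewrite -addn1 PoszD mulrDl mul1r expgzD /= [in LHS]fx IH.
- rewrite -addn1 PoszD opprD mulrDl mulN1r expgzD /=.
  suff -> : (f ^z (- i)) x = x by [].
  by rewrite -{1}fx expgz_app addNr.
Qed.

Lemma expgz_reverse f h k x : reversible_by f h ->
  h ((f ^z k) x) = (f ^z (- k)) (h x).
Proof. by move=> /(@expgz_conjV _ _ _ k) /(congr1 (fun g : iet R => g x)). Qed.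

Lemma minimal_orbit f x y (e : R) : minimal_iet f -> 0 < e -> e <= 1 - val y ->
  exists k, val y < val ((f ^z k) x) < val y + e.
Proof.
move=> minf e0 e1; have y0 := val_ge0 y.
have yI : 0 <= val y + e / 2 < 1 by lra.
have e20 : 0 < e / 2 by lra.
have [p [[w [n fn] <-]]] := minf x _ yI _ (nbhsx_ballx (val y + e / 2) _ e20).
rewrite /ball /= ltr_distlC => ne.
have [k wk] : exists k, w = (f ^z k) x; last by exists k; rewrite -wk; lra.
case: fn => ->; first by exists n.
by exists (- n%:Z); rewrite expgzN.
Qed.

Lemma near_right_witness (P : R -> Prop) :
  (\forall e \near 0^'+, P e) -> exists2 e, 0 < e & P e.
Proof.
move=> nP; near (0 : R)^'+ => e; exists e; last by near: e.
by near: e; exact: nbhs_right_gt.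
Unshelve. all: by end_near. Qed.

(** A nonzero period makes the orbit finite, so it misses a small interval to the right of [0]. *)
Lemma minimal_aperiodic f x k : minimal_iet f -> (f ^z k) x = x -> k = 0.
Proof.
move=> minf fkx; apply/eqP/negPn/negP => k0.
pose s := [seq val ((f ^z i%:Z) x) | i <- iota 0 `|k|].
have [e e0 [es e1]] : exists2 e : R, 0 < e &
    (forall c, c \in s -> ~~ (0 < c < 0 + e)) /\ e <= 1.
  by apply: (near_right_witness (filterI (near_gap_right _ _) (nbhs_right_le ltr01))).
have [i] := @minimal_orbit f x (ipt0 R) e minf e0 ltac:(by rewrite subr0).
apply/negP/es; apply/mapP; exists `|(i %% k)%Z|%N.
  by rewrite mem_iota add0n -ltz_nat gez0_abs ?modz_ge0 // ltz_mod.
rewrite gez0_abs ?modz_ge0 // {1}(divz_eq i k) addrC expgzD; congr (val ((f ^z _) _)).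
exact: expgz_fix.
Qed.

Lemma minimal_orbit_inj f x : minimal_iet f -> injective (fun k => (f ^z k) x).
Proof.
move=> minf i j /= /(congr1 (f ^z (- j))); rewrite !expgz_app addNr => ij.
by have := minimal_aperiodic minf ij; lia.
Qed.

Lemma minimal_commute_fix f g x :
  minimal_iet f -> commute f g -> g x = x -> g = 1%g.
Proof.
move=> minf fg gx; apply: iet_ext => y.
have gk k : g ((f ^z k) x) = (f ^z k) x.
  have comm_k : commute g (f ^z k).
    case: k => n; [|apply: commuteV]; exact/commuteX/commute_sym.
  by rewrite -[in RHS]gx; exact: (congr1 (fun g : iet R => g x) comm_k).
have y1 : 0 < 1 - val y by rewrite subr_gt0 val_lt1.
have [e e0 [gy ey]] := near_right_witness
  (filterI (near_translation_right g y) (nbhs_right_le y1)).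
have [k /andP[yk ke]] := minimal_orbit x minf e0 ey.
(* To the right of [y], [g] is a translation with a fixed point, so its translation length is
   zero. *)
apply: val_inj; have := gy _ (introT andP (conj (ltW yk) ke)).
by rewrite gk => /(@addrI _ _ _ _) /oppr_inj.
Qed.

Lemma minimal_reverse_free f h x : minimal_iet f -> reversible_by f h -> h x <> x.
Proof.
move=> minf fh hx; have x1 : 0 < 1 - val x by rewrite subr_gt0 val_lt1.
have [e e0 [hxe ex]] := near_right_witness
  (filterI (near_translation_right h x) (nbhs_right_le x1)).
have [k /andP[xk ke]] := minimal_orbit x minf e0 ex.
have : h ((f ^z k) x) = (f ^z k) x.
  apply: val_inj; have := hxe _ (introT andP (conj (ltW xk) ke)).
  by rewrite hx => /(@addIr _ _ _ _).
rewrite (expgz_reverse _ _ fh) hx => /(minimal_orbit_inj minf) k0.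
have {}k0 : k = 0 by lia.
by rewrite k0 ltxx in xk.
Qed.

(** The elements conjugating [f] to [f] or to [f^-1] form a subgroup containing both generators. *)
Lemma generated_conj f h g : reversible_by f h ->
  generated_subgroup [set f; h] g -> commute f g \/ reversible_by f g.
Proof.
rewrite /reversible_by => fh.
have -> : commute f g \/ (g * f * g^-1 = f^-1)%g <->
    (g * f * g^-1 = f \/ g * f * g^-1 = f^-1)%g.
  by split=> -[H|H]; [left; rewrite -H mulgK|right|left; apply: (mulIg g^-1%g); rewrite H mulgK|right].
move=> /(_ [set g | g * f * g^-1 = f \/ g * f * g^-1 = f^-1]%g); apply.
  have conjM (a b c : iet R) : (a * b * c * (a * b)^-1 = a * (b * c * b^-1) * a^-1)%g.
    by rewrite invgM !mulgA.
  have conj_inv (a b : iet R) : (a * b^-1 * a^-1 = (a * b * a^-1)^-1)%g.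
    by rewrite !invgM invgK !mulgA.
  split=> [|a b /= [Ha|Ha] [Hb|Hb]|a /= [Ha|Ha]].
  - by left; rewrite mul1g invg1 mulg1.
  - by left; rewrite conjM Hb.
  - by right; rewrite conjM Hb conj_inv Ha.
  - by right; rewrite conjM Hb.
  - by left; rewrite conjM Hb conj_inv Ha invgK.
  - by left; rewrite invgK -[in LHS]Ha !mulgA mulVg mul1g mulgVK.
  - right; rewrite invgK; apply: invg_inj; rewrite !(invgM, invgK).
    by rewrite -Ha !mulgA mulVg mul1g mulgVK.
by move=> a /= [->|->]; [left; rewrite mulgK|right].
Qed.

Lemma reversible_acts_freely f h : minimal_iet f -> reversible_by f h ->
  acts_freely (generated_subgroup [set f; h]).
Proof.
move=> minf fh g Hg [x gx]; have [fg|fg] := generated_conj fh Hg.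
  exact: minimal_commute_fix gx.
by have := minimal_reverse_free minf fg gx.
Qed.

End Minimal.

(** * Periodic IETs *)

Section Periodic.
Variable R : realType.
Local Notation I := (unit_itv R).
Implicit Types (f : iet R) (x y : I).

Lemma expg_app f i j x : (f ^+ i)%g ((f ^+ j)%g x) = (f ^+ (i + j))%g x.
Proof. by rewrite expgnDr. Qed.

(* If [(f ^+ k) x] is the least point of the orbit of [x], the involution sends
   [x] to [(f ^+ (2 k)) x]: on the orbit based at its least point [r] it maps
   [f^i r] to [f^(-i) r]. *)
Lemma periodic_strongly_reversible f : periodic_iet f -> strongly_reversible f.
Proof.
move=> [[//|n] _ fn].
pose least k x := forall i, val ((f ^+ k)%g x) <= val ((f ^+ i)%g x).
have fper a b k x : a = (b + k * n.+1)%N -> (f ^+ a)%g x = (f ^+ b)%g x.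
  by move=> ->; rewrite expgnDr mulnC expgnA fn expg1n mulg1.
have least_ex x : exists k, least k x.
  have [k _ kmin] := @Order.TotalTheory.arg_minP _ _ _ ord0 xpredT
    (fun i : 'I_n.+1 => val ((f ^+ i)%g x)) isT.
  exists k => i; have := kmin (Ordinal (ltn_pmod i (ltn0Sn n))) isT.
  by rewrite /= (@fper i (i %% n.+1)%N (i %/ n.+1)%N) // addnC -divn_eq.
have [kap kapP] := choice least_ex.
pose h x := (f ^+ (kap x).*2)%g x.
(* The chosen exponent [kap x] is immaterial: all least exponents lead to the same point. *)
have hE k x : least k x -> h x = (f ^+ k.*2)%g x.
  move=> kx; have kk : (f ^+ k)%g x = (f ^+ kap x)%g x.
    by apply: val_inj; apply/eqP; rewrite eq_le kx kapP.
  by rewrite /h -!addnn -!expg_app -kk expg_app addnC -expg_app kk expg_app.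
have hfE j l x : (f ^+ (j + l))%g x = (f ^+ kap x)%g x ->
    h ((f ^+ l)%g x) = (f ^+ (j.*2 + l))%g x.
  move=> jl; rewrite (@hE j) ?expg_app // => i; rewrite !expg_app jl.
  exact: kapP.
have hh x : h (h x) = x.
  (* Modulo the period [n.+1], [n * kap x] stands for [- kap x]. *)
  rewrite {2}/h (@hfE (n * kap x)%N).
    by rewrite (@fper _ 0 (kap x).*2) //; lia.
  by apply: (@fper _ _ (kap x)); lia.
have hiet : is_iet h.
  have bs : exists s, forall i, (i < n.+1.*2)%N -> broken_at s (f ^+ i)%g.
    elim: (n.+1.*2) => [|m [s sP]]; first by exists [::].
    have [t tP] := is_iet_broken (iet_prop (f ^+ m)%g).
    exists (s ++ t) => i; rewrite ltnS leq_eqVlt => /orP[/eqP->|im] x y xy st.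
      by apply: tP => // c ct; apply: st; rewrite mem_cat ct orbT.
    by apply: sP => // c cs; apply: st; rewrite mem_cat cs.
  have [s sP] := bs.
  apply: (@broken_is_iet _ s); first by exists h.
  move=> x y xy sxy.
  have tr i : val ((f ^+ i)%g y) - val ((f ^+ i)%g x) = val y - val x.
    have E z : (f ^+ i)%g z = (f ^+ (i %% n.+1))%g z.
      by apply: (@fper _ _ (i %/ n.+1)%N); rewrite addnC -divn_eq.
    rewrite !E; apply: sP => //.
    by rewrite -addnn ltn_addr // ltn_pmod.
  (* All powers of [f] move [x] and [y] in parallel, so an exponent least for [x] is least for
     [y]. *)
  rewrite (@hE (kap x) y) ?tr // => i.
  by have := kapP x i; have := tr i; have := tr (kap x); lra.
exists (Iet hiet); split; first by apply: iet_ext => x; exact: hh.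
apply: (mulgI f); rewrite mulgV; apply: iet_ext => x.
have -> : (f * (Iet hiet * f * Iet hiet))%g x = f (h ((f ^+ (kap x).*2.+1)%g x)).
  by rewrite expgS.
rewrite (@hfE (n * (kap x).+1)%N).
  have -> y : f y = (f ^+ 1)%g y by [].
  by rewrite expg_app (@fper _ 0 (kap x).+1.*2) //; lia.
by apply: (@fper _ _ (kap x).+1); lia.
Qed.

End Periodic.

(** * Linked indices and resolved points *)

Section Resolved.
Variable R : realType.
Local Notation I := (unit_itv R).
Implicit Types (f h : iet R) (x y z : I).

Definition linked f z i j := left_translation (f ^z (j - i)) ((f ^z i) z).

Definition resolved f z := exists N : nat, forall i j : int,
  (N <= `|i|)%N -> (N <= `|j|)%N -> linked f z i j.

Lemma linked_trans f z i j k : linked f z i j -> linked f z j k -> linked f z i k.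
Proof.
move=> ij jk; rewrite /linked; have -> : k - i = (k - j) + (j - i) by lia.
rewrite expgzD; apply: left_translationM => //.
by rewrite expgz_app subrK.
Qed.

Lemma linked_sym f z i j : linked f z i j -> linked f z j i.
Proof.
move=> /left_translationV; rewrite -expgzN expgz_app subrK /linked.
by rewrite opprB.
Qed.

Lemma linked_all f z : (forall i, left_translation f ((f ^z i) z)) ->
  forall i j, linked f z i j.
Proof.
move=> fz; have nxt i : linked f z i (i + 1).
  by rewrite /linked [i + 1]addrC addrK; exact: fz.
have up i (n : nat) : linked f z i (i + n.+1%:Z).
  elim: n => [|n IH]; first exact: nxt.
  by rewrite -addn1 PoszD addrA; exact: linked_trans IH (nxt _).
move=> i j; have [ij|ij|<-] := ltgtP i j.
- have -> : j = i + `|j - i|.-1.+1%:Z by lia.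
  exact: up.
- apply: linked_sym; have -> : i = j + `|i - j|.-1.+1%:Z by lia.
  exact: up.
(* Reflexivity is not automatic, as it fails at the point [0]; it comes from going to [i + 1] and
   back. *)
- exact: linked_trans (nxt i) (linked_sym (nxt i)).
Qed.

Lemma orbit_leaves_finite f (s : seq I) z : minimal_iet f ->
  exists N : nat, forall i : int, (N <= `|i|)%N -> (f ^z i) z \notin s.
Proof.
move=> minf; elim: s => [|c s [N IH]]; first by exists 0%N.
have [[k kc]|nc] := pselect (exists k, (f ^z k) z = c).
  exists (maxn N `|k|.+1) => i; rewrite geq_max => /andP[/IH si ki].
  rewrite inE negb_or si andbT; apply/eqP; rewrite -kc.
  by move=> /(minimal_orbit_inj minf) ik; rewrite ik ltnn in ki.
exists N => i /IH si; rewrite inE negb_or si andbT.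
by apply/eqP => ic; apply: nc; exists i.
Qed.

(** Write [f^(j - i)] as [h^-1 f^(i - j) h]. For large indices the orbit avoids the breaks of [h],
    and reversal only negates indices, preserving absolute values. *)
Lemma resolved_reverse f h z : minimal_iet f -> reversible_by f h ->
  resolved f (h z) -> resolved f z.
Proof.
move=> minf fh [N Nz]; have [s hs] := breaks_finite h.
have [M Mz] := orbit_leaves_finite s z minf.
exists (maxn N M) => i j; rewrite !geq_max => /andP[iN /Mz/hs iM] /andP[jN /Mz/hs jM].
rewrite /linked; have -> : f ^z (j - i) = (h^-1 * (f ^z ((- j) - (- i)) * h))%g.
  have -> : - j - - i = - (j - i) by lia.
  by rewrite -(expgz_conjV _ fh) mulKg.
apply: left_translationM.
  apply: left_translationM => //; rewrite (expgz_reverse _ _ fh).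
  by apply: Nz; rewrite abszN.
have -> : (f ^z (- j - - i) * h)%g ((f ^z i) z) = h ((f ^z j) z).
  by rewrite /= !(expgz_reverse _ _ fh) expgz_app subrK.
exact: left_translationV.
Qed.

(* Here the breaks of the powers of [f] stay close to the two ends of the
   orbit segments, whatever the exponent. *)
Lemma resolved_breaks f : (forall z, resolved f z) ->
  exists s : seq I, forall n z, ~ left_translation (f ^z n) z ->
    z \in s \/ (f ^z n) z \in s.
Proof.
move=> fres; have [t ft] := breaks_finite f.
have [s sP] : exists s : seq I, forall b, b \in t -> forall i j,
    ~ linked f b i j -> (f ^z i) b \in s \/ (f ^z j) b \in s.
  elim: t {ft} => [|b t [s IH]]; first by exists [::].
  have [N bN] := fres b.
  (* The orbit segment with indices from [-N] to [N - 1] covers all indices not yet known to be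
     linked. *)
  pose u := [seq (f ^z (i%:Z - N%:Z)) b | i <- iota 0 (N.*2)].
  have memu i : ~~ (N <= `|i|)%N -> (f ^z i) b \in u.
    rewrite -ltnNge => iN; apply/mapP; exists `|(i + N%:Z)%R|%N.
      by rewrite mem_iota; lia.
    by congr (((f ^z _) : iet R) _); lia.
  exists (u ++ s) => c; rewrite inE => /orP[/eqP-> i j nl|ct i j nl].
    rewrite !mem_cat.
    have [iN|/memu->] := boolP (N <= `|i|)%N; last by left.
    have [jN|/memu->] := boolP (N <= `|j|)%N; last by right.
    by case: nl; exact: bN.
  by rewrite !mem_cat; case: (IH c ct i j nl) => ->; rewrite orbT; [left|right].
exists s => n z nz.
have [i it] : exists i, (f ^z i) z \in t.
  apply: contrapT => nt; apply: nz.
  have := @linked_all f z _ 0 n; rewrite /linked subr0; apply => i.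
  by apply: ft; apply/negP => it; apply: nt; exists i.
(* Seen from the break [f^i z], the points [z] and [f^n z] have indices [- i] and [n - i]. *)
have := sP _ it (- i) (n - i).
rewrite /linked !expgz_app addNr subrK opprK subrK; exact.
Qed.

End Resolved.

(** * Reversers of minimal IETs have finite order *)

Section InfiniteOrder.
Variable R : realType.
Local Notation I := (unit_itv R).
Implicit Types (f h : iet R) (x y z : I).

(* Choose [k] with [f^k x0] just to the right of [h x0].  The finitely many
   points [f^k c], [c \in s], cannot meet all the small disjoint intervals to the
   right of the [f^m (h x0)], [m <= size s]; when the [m]-th one is avoided,
   [f^(2m - k)] translates an interval starting at [h (f^m x0)], which forces
   [h (h x)] to be slightly less than [x] for [x = f^m x0]. *)
Lemma reversible_unresolved f h : minimal_iet f -> reversible_by f h ->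
  exists z, ~ resolved f z.
Proof.
move=> minf fh; apply: contrapT => /forallNP nres.
have [s sP] := resolved_breaks (fun z => contrapT (nres z)).
pose x0 := ipt0 R; pose y0 := h x0.
pose x (m : 'I_(size s).+1) := (f ^z m%:Z) x0.
pose y (m : 'I_(size s).+1) := (f ^z (- m%:Z)) y0.
pose p (m : 'I_(size s).+1) := (f ^z m%:Z) y0.
have y01 : 0 < 1 - val y0 by rewrite subr_gt0 val_lt1.
have [e e0 [e1 eP]] : exists2 e : R, 0 < e & e <= 1 - val y0 /\ forall m,
  [/\ forall c, c \in map val s -> ~~ (val (y m) < c < val (y m) + e),
      forall z, val y0 <= val z < val y0 + e ->
        val ((f ^z (- m%:Z)) z) - val ((f ^z (- m%:Z)) y0) = val z - val y0,
      forall z, val (y m) <= val z < val (y m) + e ->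
        val ((f ^z (m%:Z + m%:Z)) z) - val ((f ^z (m%:Z + m%:Z)) (y m)) = val z - val (y m),
      forall z, val (y m) <= val z < val (y m) + e ->
        val (h z) - val (h (y m)) = val z - val (y m) &
      (forall c, c \in [seq val (p m') | m' : 'I_(size s).+1] ->
        ~~ (val (p m) < c < val (p m) + e)) /\
      forall c, c \in [:: (val (x m) - val (h (y m))) / 2] -> ~~ (0 < c < 0 + e)].
  apply: near_right_witness; near=> e; split.
    by near: e; exact: nbhs_right_le.
  near: e; apply: filter_forall => m; near=> e; split; last split.
  - by near: e; exact: near_gap_right.
  - by near: e; exact: near_translation_right.
  - by near: e; exact: near_translation_right.
  - by near: e; exact: near_translation_right.
  - by near: e; exact: near_gap_right.
  - by near: e; exact: near_gap_right.
have [k /andP[wy we]] := minimal_orbit x0 minf e0 e1.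
pose w := (f ^z k) x0; rewrite -/w in wy we.
have [m mP] : exists m, forall z, val (y m) < val z <= val (y m) + (val w - val y0) ->
    left_translation (f ^z (m%:Z + m%:Z - k)) z.
  apply: contrapT => /forallNP bad.
  have badm m : exists c, c \in s /\
      val (p m) < val ((f ^z k) c) < val (p m) + e.
    have [z /not_implyP[/andP[yz zw] nz]] : exists z,
        ~ (val (y m) < val z <= val (y m) + (val w - val y0) ->
           left_translation (f ^z (m%:Z + m%:Z - k)) z).
      by apply/existsNP; exact: bad.
    have [gap _ tr _ _] := eP m.
    have ze : val z < val (y m) + e by clear -zw we; lra.
    have [zs|zs] := sP _ _ nz.
      by have := gap _ (map_f val zs); rewrite yz ze.
    (* Applying [f^k] to this point gives [f^(2m) z], just to the right of [p m = f^(2m) (y m)]. *)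
    exists ((f ^z (m%:Z + m%:Z - k)) z); split=> //.
    rewrite expgz_app addrC subrK.
    have := tr z; rewrite (ltW yz) ze => /(_ isT).
    rewrite expgz_app addrK -/(p m).
    by clear -yz ze; lra.
  have [c cP] := choice badm.
  (* No interval [(p m, p m + e)] contains another [p m'], so these intervals are disjoint; [s]
     would then have more points than its size. *)
  have cinj : injective c.
    suff lt_absurd m m' : c m = c m' -> val (p m) < val (p m') -> False.
      move=> m m' cc; have [pp|pp|/val_inj] := ltgtP (val (p m)) (val (p m')).
      - by case: (lt_absurd _ _ cc pp).
      - by case: (lt_absurd _ _ (esym cc) pp).
      - by move=> /(minimal_orbit_inj minf) [] /val_inj.
    move=> cc pp; have [_ _ _ _ [gap _]] := eP m.
    have := gap _ (codom_f (fun m => val (p m)) m').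
    have [_ /andP[_ pe]] := cP m; have [_ /andP[pe' _]] := cP m'.
    by rewrite pp (lt_trans pe') // -cc.
  have cs : {subset [seq c m | m : 'I_(size s).+1] <= s}.
    by move=> _ /mapP[m _ ->]; case: (cP m).
  suff /uniq_leq_size /(_ cs) : uniq [seq c m | m : 'I_(size s).+1].
    by rewrite size_map -cardE card_ord ltnn.
  by rewrite map_inj_uniq ?enum_uniq.
have [_ tr0 _ trh [_ gap]] := eP m.
have := tr0 w; rewrite (ltW wy) we => /(_ isT); rewrite -/(y m) => E0.
set v := (f ^z (- m%:Z)) w in E0.
have yv : val (y m) <= val v <= val (y m) + (val w - val y0) by clear -wy E0; lra.
have E1 : val ((f ^z (m%:Z + m%:Z - k)) v) - val ((f ^z (m%:Z + m%:Z - k)) (y m)) =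
    val v - val (y m).
  apply: translation_on; first by case/andP: yv.
  move=> z /andP[yz zv]; apply: mP; rewrite yz (le_trans zv) //.
  by case/andP: yv.
have vx : (f ^z (m%:Z + m%:Z - k)) v = x m.
  by rewrite /v /w /x !expgz_app; congr (((expgz f _) : iet R) _); lia.
(* Both sides are [f^(m - k) (h x0)], since [v = f^(k - m) x0]. *)
have vh : (f ^z (m%:Z + m%:Z - k)) (y m) = h v.
  rewrite /v /w /y /y0 expgz_app !(expgz_reverse _ _ fh) expgz_app.
  by congr (((expgz f _) : iet R) _); lia.
have E2 : val (h v) - val (h (y m)) = val v - val (y m).
  by apply: trh; clear -yv wy we; lra.
(* Adding [E1] and [E2] gives [val (x m) - val (h (y m)) = 2 d] with [d = val w - val y0] in
   [(0, e)], while [e] was chosen so that this interval excludes half the difference. *)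
have /negP[] := gap _ (mem_head _ _).
by rewrite vx vh in E1; clear -wy we E0 E1 E2; lra.
Unshelve. all: by end_near. Qed.

Lemma reversible_finite_order f h : minimal_iet f -> reversible_by f h ->
  periodic_iet h.
Proof.
move=> minf fh; have [z0 z0P] := reversible_unresolved minf fh.
have [t ft] := breaks_finite f.
have unres a : ~ resolved f ((h ^+ a)%g z0).
  by elim: a => [//|a IH]; rewrite expgS => /(resolved_reverse minf fh).
have hit a : exists i, (f ^z i) ((h ^+ a)%g z0) \in t.
  apply: contrapT => nt; apply: (unres a); exists 0%N => i j _ _.
  by apply: linked_all => l; apply: ft; apply/negP => lt; apply: nt; exists l.
have [i iP] := choice hit; pose b a := (f ^z (i a)) ((h ^+ a)%g z0).
(* Pigeonhole: each [h^a z0] is unresolved, so its [f]-orbit meets the finite list [t]. *)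
have [a [c [ac bac]]] : exists a c, (a < c)%N /\ b a = b c.
  apply: contrapT => inj.
  have bt : {subset [seq b a | a <- iota 0 (size t).+1] <= t}.
    by move=> _ /mapP[a _ ->]; exact: iP.
  suff /uniq_leq_size /(_ bt) : uniq [seq b a | a <- iota 0 (size t).+1].
    by rewrite size_map size_iota ltnn.
  rewrite map_inj_uniq ?iota_uniq // => a c bac.
  by have [ac|ac|//] := ltngtP a c; case: inj; [exists a, c|exists c, a].
pose l := i c - i a; pose d := (c - a)%N.
have fix_a : (f ^z l * h ^+ d)%g ((h ^+ a)%g z0) = (h ^+ a)%g z0.
  rewrite /= expg_app subnK ?(ltnW ac) //; apply: (can_inj (iet_invK (f ^z i a))).
  by rewrite expgz_app addrC subrK; exact: esym.
have gen : generated_subgroup [set f; h] (f ^z l * h ^+ d)%g.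
  move=> H [H1 HM HV] fhH.
  have HX g n : H g -> H (g ^+ n)%g.
    by move=> Hg; elim: n => [|n IH] //; rewrite expgS; exact: HM.
  apply: HM; last by apply: HX; apply: fhH; right.
  have Hf : H f by apply: fhH; left.
  by case: (l) => n; [exact: HX|apply/HV/HX].
have {}fix_a : (f ^z l * h ^+ d = 1)%g.
  by apply: (reversible_acts_freely minf fh gen); exists ((h ^+ a)%g z0).
have hd : (h ^+ d = f ^z (- l))%g.
  by apply: (mulgI (f ^z l)); rewrite fix_a -expgzD subrr.
(* Commuting with [h] while being inverted by it gives [f^l = f^-l], and orbits are injective. *)
have l0 : l = 0.
  have : (h * f ^z (- l) = f ^z (- l) * h)%g by rewrite -hd -expgS -expgSr.
  rewrite (expgz_conjV _ fh) opprK => /mulIg /(congr1 (fun g : iet R => g z0)).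
  by move=> /(minimal_orbit_inj minf); lia.
by exists d; [rewrite subn_gt0|rewrite hd l0].
Qed.

End InfiniteOrder.

Theorem theorem4 (R : realType) :
  [/\ (forall f h : iet R, minimal_iet f -> reversible_by f h ->
         acts_freely (generated_subgroup [set f; h])),
      ~ (exists f h : iet R,
           [/\ minimal_iet f, infinite_order h & reversible_by f h]) &
      (forall f : iet R, periodic_iet f -> strongly_reversible f)].
Proof.
split; [exact: reversible_acts_freely| |exact: periodic_strongly_reversible].
by move=> [f [h [minf hinf /(reversible_finite_order minf)]]].
Qed.
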